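(* There is an upward planar graph $G$ with $\operatorname{pn}(G)\geq \operatorname{tn}(G)\geq 5$.
   Context: All graphs are finite and directed. A directed acyclic graph $G$ is upward planar if it has a drawing in the Euclidean plane in which vertices are points, every edge $(u,v)$ is a strictly $y$-monotone curve with lower endpoint $u$ and upper endpoint $v$, and every edge is disjoint from other points and curves except in its endpoints. Given a topological ordering $<$ of $G$ (a linear ordering of the vertices with $u<v$ for every edge $(u,v)$), two edges $(u_1,v_1),(u_2,v_2)$ cross if $u_1<u_2<v_1<v_2$ or $u_2<u_1<v_2<v_1$. A book embedding of $G$ with $k$ pages consists of a topological ordering $<$ of $G$ (the spine ordering) and a partition of $E(G)$ into $k$ sets (pages) such that no page contains two edges that cross with respect to $<$. The page number $\operatorname{pn}(G)$ is the minimum $k$ for which $G$ admits a book embedding with $k$ pages. A $k$-twist with respect to $<$ is a set of $k$ edges that pairwise cross with respect to $<$. The twist number $\operatorname{tn}(G)$ is the smallest $k$ for which there is a topological ordering of $G$ with no $(k+1)$-twist. *)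

(* Defs.v *)
From HB Require Import structures.
From mathcomp Require Import all_boot all_order all_algebra.
From mathcomp Require Import all_classical all_reals all_analysis.
Set Implicit Arguments.
Unset Strict Implicit.
Unset Printing Implicit Defensive.
Import Order.TTheory GRing.Theory Num.Theory.
Import numFieldNormedType.Exports.
Local Open Scope classical_set_scope.
Local Open Scope ring_scope.

(* A loop is a [ucycle] of size 1 and a pair of opposite edges one of size 2,
   so both are excluded. *)
Definition acyclic (T : finType) (e : rel T) : Prop :=
  forall c : seq T, ucycle e c -> c = [::].

Record dag := Dag {
  vertex :> finType;
  arc : rel vertex;
  arc_acyclic : acyclic arc
}.

Definition edge (G : dag) : finType := {e : G * G | arc e.1 e.2}.
Definition edge_tail (G : dag) (e : edge G) : G := (val e).1.
Definition edge_head (G : dag) (e : edge G) : G := (val e).2.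

Section UpwardPlanar.
Variables (R : realType) (G : dag).

Definition curve_image (g : R -> R * R) : set (R * R) := g @` `[0, 1].

Definition strictly_y_monotone_curve (g : R -> R * R) (p q : R * R) : Prop :=
  [/\ {within `[0, 1], continuous g}, g 0 = p, g 1 = q &
      forall s t : R, 0 <= s -> s < t -> t <= 1 -> (g s).2 < (g t).2].

(* In the last clause [e] and [f] play symmetric roles, so a common point of
   two distinct edges is an endpoint of both. *)
Definition upward_planar_drawing
    (pos : G -> R * R) (g : edge G -> R -> R * R) : Prop :=
  [/\ injective pos,
      forall e, strictly_y_monotone_curve (g e) (pos (edge_tail e)) (pos (edge_head e)),
      forall e w, curve_image (g e) (pos w) -> w = edge_tail e \/ w = edge_head e &
      forall e f p, e != f -> curve_image (g e) p -> curve_image (g f) p ->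
        p = pos (edge_tail e) \/ p = pos (edge_head e)].

Definition upward_planar : Prop :=
  exists (pos : G -> R * R) (g : edge G -> R -> R * R),
    upward_planar_drawing pos g.

End UpwardPlanar.

Section BookEmbeddings.
Variable G : dag.
Implicit Types lt : rel G.

Definition topological_ordering lt : Prop :=
  [/\ irreflexive lt, transitive lt,
      forall u v : G, u != v -> lt u v || lt v u &
      forall u v : G, arc u v -> lt u v].

Definition crosses lt (e f : edge G) : bool :=
  [&& lt (edge_tail e) (edge_tail f), lt (edge_tail f) (edge_head e) & lt (edge_head e) (edge_head f)] ||
  [&& lt (edge_tail f) (edge_tail e), lt (edge_tail e) (edge_head f) & lt (edge_head f) (edge_head e)].

(* Pages may be empty, which does not affect the minimum number of pages. *)
Definition book_embedding lt (k : nat) (page : edge G -> 'I_k) : Prop :=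
  topological_ordering lt /\
  forall e f : edge G, page e = page f -> ~~ crosses lt e f.

Definition twist lt (k : nat) (S : {set edge G}) : Prop :=
  #|S| = k /\ {in S &, forall e f, e != f -> crosses lt e f}.

Definition has_book_embedding (k : nat) : Prop :=
  exists lt (page : edge G -> 'I_k), book_embedding lt page.

Definition has_twist_free_ordering (k : nat) : Prop :=
  exists lt, topological_ordering lt /\ forall S, ~ twist lt k.+1 S.

Lemma topological_ordering_exists : exists lt, topological_ordering lt.
Proof.
have nback u v : arc u v -> ~~ connect (@arc G) v u.
  move=> uv; apply/negP => /connectP[p pP uE].
  move: uv; rewrite uE; case/shortenP: pP => q qP qU _ qv.
  suff: v :: q = [::] by [].
  by apply: (@arc_acyclic G); rewrite /ucycle /= rcons_path qP qv.
pose r (x : G) := #|[set y | connect (@arc G) x y]%SET|.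
have rlt u v : arc u v -> (r v < r u)%N.
  move=> uv; apply: proper_card; apply/properP; split.
    apply/fintype.subsetP => y; rewrite !inE.
    by apply: connect_trans; exact: connect1.
  by exists u; rewrite !inE ?connect0 // (negbTE (nback _ _ uv)).
exists (fun x y => (r y < r x)%N ||
  ((r x == r y) && (enum_rank x < enum_rank y)%N)); split.
- by move=> x; rewrite /= ltnn eqxx ltnn.
- move=> y x z /=.
  case/orP=> [xy|/andP[/eqP xy xy']]; case/orP=> [yz|/andP[/eqP yz yz']].
  + by rewrite (ltn_trans yz xy).
  + by rewrite -yz xy.
  + by rewrite xy yz.
  + by rewrite xy yz eqxx (ltn_trans xy' yz') orbT.
- move=> u v uv; case: (ltngtP (r u) (r v)) => //= _.
  by rewrite -neq_ltn; apply: contra uv => /eqP/val_inj/enum_rank_inj ->.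
- by move=> u v /rlt ->.
Qed.

Lemma crossesxx lt (e : edge G) : irreflexive lt -> crosses lt e e = false.
Proof. by move=> ltxx; rewrite /crosses ltxx. Qed.

Lemma page_number_subproof : exists k, `[< has_book_embedding k >].
Proof.
have [lt ltT] := topological_ordering_exists.
exists #|edge G|; apply/asboolP; exists lt, enum_rank; split => // e f.
by move=> /enum_rank_inj ->; case: ltT => ltxx _ _ _; rewrite crossesxx.
Qed.

Lemma twist_number_subproof : exists k, `[< has_twist_free_ordering k >].
Proof.
have [lt ltT] := topological_ordering_exists.
exists #|edge G|; apply/asboolP; exists lt; split => // S [SE _].
by have := max_card (mem S); rewrite SE ltnn.
Qed.

Definition page_number : nat := ex_minn page_number_subproof.

Definition twist_number : nat := ex_minn twist_number_subproof.

End BookEmbeddings.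

(* Main.v *)
From Stdlib Require Import ZArith.
Require Import Defs.
From mathcomp Require Import all_boot all_order all_algebra.
From mathcomp Require Import all_classical all_reals all_analysis.
From mathcomp Require Import zify ring lra ssrZ.
Set Implicit Arguments.
Unset Strict Implicit.
Unset Printing Implicit Defensive.
Import Order.TTheory GRing.Theory Num.Theory.
Import numFieldNormedType.Exports.
Delimit Scope Z_scope with coqZ.

(** The inequality between the two numbers holds in every graph: pairwise
    crossing edges need pairwise different pages, so a spine ordering that
    admits [k] pages has no twist of more than [k] edges
    ([twist_number_leq_page_number]).  All the work is to exhibit an upward
    planar graph in which every topological ordering contains a 5-twist.

    The graph has 31 vertices and 77 arcs.  Its vertices are numbered along one
    of its topological orderings, and drawing vertex [i] at height [i], at a
    suitable integer abscissa, with straight arcs, gives an upward planar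
    drawing.  That no two arcs meet is a matter of signs of integer
    determinants ([integer_upward_planar]): of two arcs, one always lies on one
    side of the line through the other.

    For the lower bound, observe that five arcs [u_i -> v_i] form a twist, in
    this order, exactly when
    [u_1 < u_2 < u_3 < u_4 < u_5 < v_1 < v_2 < v_3 < v_4 < v_5].
    In an ordering without 5-twist one of the nine links fails; when the other
    eight are known, the ninth is thus reversed.  Arcs between two directed
    paths have most of their links for free, so such inferences start from the
    arcs of the graph alone: for instance the arcs 0-8, 5-10, 6-20, 19-27, 21-29
    force 8 to precede 21.  The new comparisons, closed under transitivity,
    enable further inferences of this kind, and a few case distinctions on the
    order of two vertices suffice to end in a contradiction everywhere.  This
    argument is recorded as a binary tree whose inner nodes compare two
    vertices and whose 72 leaves each name a twist ([twist_cases]).  The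
    soundness of such trees ([refutes_twist_number]) reduces the lower bound to
    an evaluation. *)

(** * Twists and pages *)

Lemma twist_leq_pages (G : dag) (lt : rel G) (k : nat) (page : edge G -> 'I_k)
    (j : nat) (S : {set edge G}) :
  book_embedding lt page -> twist lt j S -> j <= k.
Proof.
move=> [_ pageP] [<- crossS]; rewrite -[k in _ <= k]card_ord.
apply: (@leq_card_in _ _ page) => e f eS fS ef; apply/eqP/negP => nef.
by have := pageP _ _ ef; rewrite crossS //; apply/negP.
Qed.

Lemma twist_number_leq_page_number (G : dag) : twist_number G <= page_number G.
Proof.
rewrite /twist_number; case: ex_minnP => m _; apply.
rewrite /page_number; case: ex_minnP => k /asboolP[lt [page ltP]] _.
apply/asboolP; exists lt; split; first by case: ltP.
by move=> S /(twist_leq_pages ltP); rewrite ltnn.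
Qed.

(** The asymmetric half of [crosses], in which [e] starts first: a list that is
    pairwise so related lists a twist by increasing tails. *)
Definition twist_succ (G : dag) (lt : rel G) : rel (edge G) := fun e f =>
  [&& lt (edge_tail e) (edge_tail f), lt (edge_tail f) (edge_head e)
    & lt (edge_head e) (edge_head f)].

Lemma twist_of_seq (G : dag) (lt : rel G) (s : seq (edge G)) :
  irreflexive lt -> pairwise (twist_succ lt) s ->
  twist lt (size s) [set e in s].
Proof.
move=> ltxx s_tw.
have succ_irr : irreflexive (twist_succ lt).
  by move=> e; rewrite /twist_succ ltxx.
have s_uniq : uniq s.
  elim: s s_tw => //= e s IHs /andP[/allP es /IHs ->]; rewrite andbT.
  by apply/negP => /es; rewrite succ_irr.
split; first by rewrite cardsE; apply/card_uniqP.
move=> e f; rewrite !inE => es fs nef.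
have : twist_succ lt e f || twist_succ lt f e.
  elim: s s_tw es fs {s_uniq} => //= g s IHs /andP[/allP gs s_tw].
  rewrite !inE => /predU1P[eq_e|es] /predU1P[eq_f|fs].
  - by rewrite eq_e eq_f eqxx in nef.
  - by rewrite eq_e gs.
  - by rewrite eq_f gs ?orbT.
  - exact: IHs.
by [].
Qed.

(** If the twist number [m] were smaller than [k], some ordering would have no
    twist of [m.+1] edges, whereas the first [m.+1] edges of a longer twist form
    one. *)
Lemma twist_number_geq (G : dag) (k : nat) :
  (forall lt, topological_ordering lt ->
     exists2 s : seq (edge G), size s = k & pairwise (twist_succ lt) s) ->
  k <= twist_number G.
Proof.
move=> twistG; rewrite /twist_number; case: ex_minnP => m /asboolP[lt [ltT no_twist]] _.
rewrite leqNgt; apply/negP => lt_mk; have [s sk s_tw] := twistG _ ltT.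
have ltxx : irreflexive lt by case: ltT.
apply: (no_twist [set e in take m.+1 s]).
have /(twist_of_seq ltxx) : pairwise (twist_succ lt) (take m.+1 s).
  by apply: subseq_pairwise s_tw; exact: take_subseq.
by rewrite size_takel ?sk.
Qed.

(** * Graphs given by a list of increasing arcs *)

Section ArcList.
Variables (n : nat) (arcs : seq (nat * nat)).
Hypothesis arcs_incr : all (fun a => a.1 < a.2 < n) arcs.

Definition list_arc : rel 'I_n := fun u v => (val u, val v) \in arcs.

Lemma list_arc_lt u v : list_arc u v -> u < v.
Proof. by move/(allP arcs_incr) => /andP[]. Qed.

Lemma list_arc_acyclic : acyclic list_arc.
Proof.
case=> // u c /andP[/= ucyc _].
have : path ltn u [seq val w | w <- rcons c u].
  by rewrite path_map; apply: sub_path ucyc => v w /list_arc_lt.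
move/(order_path_min ltn_trans)/allP/(_ (val u)).
by rewrite map_rcons mem_rcons mem_head /= ltnn => /(_ isT).
Qed.

Definition list_dag : dag := Dag list_arc_acyclic.

Definition ends (e : edge list_dag) : nat * nat :=
  (val (edge_tail e), val (edge_head e)).

Lemma ends_surjective (s : seq (nat * nat)) : {subset s <= arcs} ->
  exists es : seq (edge list_dag), [seq ends e | e <- es] = s.
Proof.
elim: s => [|[u v] s IHs] sub; first by exists [::].
have /IHs[es <-] : {subset s <= arcs} by move=> a sa; apply: sub; rewrite inE sa orbT.
have uv : (u, v) \in arcs by apply: sub; rewrite mem_head.
have /andP[/= lt_uv lt_vn] := allP arcs_incr _ uv.
pose e : edge list_dag := exist (fun a => list_arc a.1 a.2)
  (Ordinal (ltn_trans lt_uv lt_vn), Ordinal lt_vn) uv.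
by exists (e :: es).
Qed.

End ArcList.

(** * Straight-line drawings *)

Section StraightLines.
Variable R : realType.
Local Open Scope ring_scope.
Implicit Types p q a b x : R * R.

Definition segment p q (t : R) : R * R :=
  ((1 - t) * p.1 + t * q.1, (1 - t) * p.2 + t * q.2).

(** Twice the signed area of the triangle [p q x]; its sign tells on which side
    of the line [p q] the point [x] lies. *)
Definition orient p q x : R :=
  (q.1 - p.1) * (x.2 - p.2) - (q.2 - p.2) * (x.1 - p.1).

(** The segment [a b] stays on one closed side of the line [p q]; one of its
    endpoints may lie on that line, to cover arcs with a common end, but not both:
    two orientations with a nonnegative product have sum zero only if both
    vanish. *)
Definition weakly_aside p q a b : bool :=
  (0 <= orient p q a * orient p q b) && (orient p q a + orient p q b != 0).

Lemma orient_segment p q a b t :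
  orient p q (segment a b t) = (1 - t) * orient p q a + t * orient p q b.
Proof. by rewrite /orient /segment /=; ring. Qed.

Lemma orient_on_segment p q t : orient p q (segment p q t) = 0.
Proof. by rewrite orient_segment /orient; ring. Qed.

Lemma segment0 p q : segment p q 0 = p.
Proof. by rewrite /segment !subr0 !mul1r !mul0r !addr0; case: p. Qed.

Lemma segment1 p q : segment p q 1 = q.
Proof. by rewrite /segment !subrr !mul1r !mul0r !add0r; case: q. Qed.

Lemma segment_continuous p q : continuous (segment p q).
Proof.
have affine (u v : R) : continuous (fun t : R => (1 - t) * u + t * v).
  move=> t; apply: cvgD; apply: cvgMr_tmp => //.
  by apply: cvgB => //; exact: cvg_cst.
move=> t; apply: (@cvg_pair _ _ _ (nbhs t) (nbhs ((1 - t) * p.1 + t * q.1))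
  (nbhs ((1 - t) * p.2 + t * q.2))); exact: affine.
Qed.

Lemma segment_monotone p q :
  p.2 < q.2 -> strictly_y_monotone_curve (segment p q) p q.
Proof.
move=> lt_pq; split; [|exact: segment0|exact: segment1|].
  by apply: continuous_subspaceT; exact: segment_continuous.
by move=> s t _ lt_st _ /=; nra.
Qed.

Lemma segment_between p q (t : R) : p.2 < q.2 -> 0 <= t <= 1 ->
  p.2 <= (segment p q t).2 <= q.2.
Proof. by move=> lt_pq /andP[t_ge0 t_le1]; apply/andP; split=> /=; nra. Qed.

(** On the segment [a b] the orientation is an affine function of the parameter,
    so it vanishes at an inner point only if it changes sign or vanishes at both
    ends. *)
Lemma weakly_aside_meet p q a b x : weakly_aside p q a b ->
  curve_image (segment p q) x -> curve_image (segment a b) x -> x = a \/ x = b.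
Proof.
move=> /andP[same_side nz] [s _ <-] [t /= t01 ts].
have : orient p q (segment a b t) = 0 by rewrite ts orient_on_segment.
move: t01; rewrite in_itv /= -ts orient_segment => /andP[t_ge0 t_le1] on_line.
have [t0|t_neq0] := eqVneq t 0; first by left; rewrite t0 segment0.
have [t1|t_neq1] := eqVneq t 1; first by right; rewrite t1 segment1.
have {t_ge0 t_neq0} t_gt0 : 0 < t by rewrite lt_def t_neq0.
have {t_le1 t_neq1} t_lt1 : t < 1 by rewrite lt_def eq_sym t_neq1.
set oa := orient p q a in same_side nz on_line.
set ob := orient p q b in same_side nz on_line.
(* Multiplied by [oa], [on_line] is a sum of two nonnegative terms. *)
have oa0 : oa = 0.
  by apply/eqP; rewrite -sqrf_eq0; apply/eqP; nra.
have ob0 : ob = 0 by nra.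
by rewrite oa0 ob0 addr0 eqxx in nz.
Qed.

(** The condition on pairs of arcs only shows that a common point is an endpoint
    of the arc that lies aside; when this is the second arc, the condition on
    vertices and arcs turns it into an endpoint of the first one. *)
Lemma straight_line_drawing (G : dag) (pos : G -> R * R) :
  injective pos ->
  (forall u v, Defs.arc u v -> (pos u).2 < (pos v).2) ->
  (forall u v w, Defs.arc u v -> w != u -> w != v ->
     [|| (pos w).2 < (pos u).2, (pos v).2 < (pos w).2
       | orient (pos u) (pos v) (pos w) != 0]) ->
  (forall u v u' v', Defs.arc u v -> Defs.arc u' v' -> (u, v) != (u', v') ->
     weakly_aside (pos u) (pos v) (pos u') (pos v') ||
     weakly_aside (pos u') (pos v') (pos u) (pos v)) ->
  upward_planar R G.
Proof.
move=> pos_inj up off_edge aside; pose cur e := segment (pos (edge_tail e)) (pos (edge_head e)).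
have vertex_on_edge (e : edge G) w :
    curve_image (cur e) (pos w) -> w = edge_tail e \/ w = edge_head e.
  have uv : Defs.arc (edge_tail e) (edge_head e) := valP e.
  case=> t /= t01 tw; have lt_uv := up _ _ uv.
  have [->|wu] := eqVneq w (edge_tail e); first by left.
  have [->|wv] := eqVneq w (edge_head e); first by right.
  move: (off_edge _ _ _ uv wu wv); rewrite -tw orient_on_segment eqxx orbF.
  have /andP[ge_u le_v] := segment_between lt_uv t01.
  by rewrite !ltNge ge_u le_v.
exists pos, cur; split=> //.
  by move=> e; apply: segment_monotone; apply: up; exact: (valP e).
move=> e f x nef ex fx.
have nef' : (edge_tail e, edge_head e) != (edge_tail f, edge_head f).
  by rewrite -!surjective_pairing.
have [sep|sep] := orP (aside _ _ _ _ (valP e) (valP f) nef').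
  have [xE|xE] := weakly_aside_meet sep ex fx; rewrite xE in ex *;
    by have [->|->] := vertex_on_edge _ _ ex; [left|right].
exact: weakly_aside_meet sep fx ex.
Qed.

End StraightLines.

Section IntegerDrawing.
Variables (R : realType) (n : nat) (arcs : seq (nat * nat)).
Hypothesis arcs_incr : all (fun a => a.1 < a.2 < n) arcs.
Variable xs : seq Z.

(** Vertex numbers serve as heights: increasing arcs then point upwards, and
    distinct vertices get distinct points whatever the abscissae. *)
Definition point (i : nat) : Z * Z := (nth Z0 xs i, Z.of_nat i).

Definition orientZ (p q x : Z * Z) : Z :=
  ((q.1 - p.1) * (x.2 - p.2) - (q.2 - p.2) * (x.1 - p.1))%coqZ.

Definition weakly_asideZ (a b : nat * nat) : bool :=
  let o := orientZ (point a.1) (point a.2) in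
  (0 <=? o (point b.1) * o (point b.2))%coqZ &&
  ~~ (o (point b.1) + o (point b.2) =? 0)%coqZ.

Definition integer_drawing : bool :=
  all (fun a => all (fun w => [|| w <= a.1, a.2 <= w |
    ~~ (orientZ (point a.1) (point a.2) (point w) =? 0)%coqZ]) (iota 0 n)) arcs &&
  all (fun a => all (fun b =>
    [|| a == b, weakly_asideZ a b | weakly_asideZ b a]) arcs) arcs.

Local Open Scope ring_scope.

Definition realZ (z : Z) : R := (int_of_Z z)%:~R.
Definition real_point (p : Z * Z) : R * R := (realZ p.1, realZ p.2).

Lemma realZ_lt (a b : Z) : (realZ a < realZ b) = (a <? b)%coqZ.
Proof. by rewrite /realZ ltr_int; lia. Qed.

Lemma Z_of_nat_lt (i j : nat) : (Z.of_nat i <? Z.of_nat j)%coqZ = (i < j)%N.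
Proof. lia. Qed.

Lemma realZ_ge0 (a : Z) : (0 <= realZ a) = (0 <=? a)%coqZ.
Proof. by rewrite /realZ ler0z; lia. Qed.

Lemma realZ_eq0 (a : Z) : (realZ a == 0) = (a =? 0)%coqZ.
Proof. by rewrite /realZ intr_eq0; lia. Qed.

Lemma realZD (a b : Z) : realZ (a + b)%coqZ = realZ a + realZ b.
Proof. by rewrite /realZ -intrD; congr (_%:~R); lia. Qed.

Lemma realZB (a b : Z) : realZ (a - b)%coqZ = realZ a - realZ b.
Proof. by rewrite /realZ -intrB; congr (_%:~R); lia. Qed.

Lemma realZM (a b : Z) : realZ (a * b)%coqZ = realZ a * realZ b.
Proof. by rewrite /realZ -intrM; congr (_%:~R); lia. Qed.

Lemma orient_real (p q x : Z * Z) :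
  orient (real_point p) (real_point q) (real_point x) = realZ (orientZ p q x).
Proof. by rewrite /orient /orientZ /= !(realZB, realZM). Qed.

Lemma integer_upward_planar : integer_drawing -> upward_planar R (list_dag arcs_incr).
Proof.
move=> /andP[/allP off_edge /allP aside].
have asideE (a b : nat * nat) : weakly_aside (real_point (point a.1)) (real_point (point a.2))
    (real_point (point b.1)) (real_point (point b.2)) = weakly_asideZ a b.
  by rewrite /weakly_aside !orient_real -realZM -realZD realZ_ge0 realZ_eq0.
apply: (@straight_line_drawing R (list_dag arcs_incr) (fun i : 'I_n => real_point (point i))).
- move=> i j [_] /eqP; rewrite -subr_eq0 -realZB realZ_eq0 => ij.
  by apply: val_inj => /=; lia.
- by move=> u v /(list_arc_lt arcs_incr) lt_uv /=; rewrite realZ_lt Z_of_nat_lt.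
- move=> u v w uv wu wv; rewrite orient_real realZ_eq0 /= !realZ_lt.
  have /allP/(_ (val w)) := off_edge _ uv.
  rewrite mem_iota ltn_ord => /(_ isT) /or3P[le_wu|le_vw|->]; last by rewrite !orbT.
    by apply/or3P/Or31; rewrite Z_of_nat_lt ltn_neqAle le_wu andbT.
  by apply/or3P/Or32; rewrite Z_of_nat_lt ltn_neqAle le_vw andbT eq_sym.
- move=> u v u' v' uv uv' neq.
  have := allP (aside _ uv) _ uv'; rewrite -!asideE /= => /or3P[/eqP[uu vv]|->|->] //; last by rewrite orbT.
  by case/eqP: neq; congr (_, _); exact: val_inj.
Qed.

End IntegerDrawing.

(** * Case trees over the comparisons of two vertices *)

(** [Compare u v t1 t2] treats the orderings with [u] before [v] in [t1] and the
    others in [t2]; [Twist s] claims that the arcs of [s], listed by increasing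
    tails, form a twist in every ordering that remains. *)
Inductive case_tree :=
  | Twist of seq (nat * nat)
  | Compare of nat & nat & case_tree & case_tree.

Section CaseTree.
Variables (n k : nat) (arcs : seq (nat * nat)).
Hypothesis arcs_incr : all (fun a => a.1 < a.2 < n) arcs.
Implicit Types (rows : seq N) (t : case_tree).

(** What is known of the ordering is the reflexive and transitive closure of
    some comparisons: bit [v] of row [u] is set when [u] is known to be equal to
    or to precede [v].  Reflexivity makes [learn] uniform, as the rows to be
    enlarged are those with bit [u] set, including row [u]. *)
Definition known rows (u v : nat) : bool := N.testbit (nth N0 rows u) (N.of_nat v).

Definition learn rows (u v : nat) : seq N :=
  let above_v := nth N0 rows v in
  [seq if N.testbit row (N.of_nat u) then N.lor row above_v else row | row <- rows].

Definition initial_rows : seq N :=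
  foldl (fun rows a => learn rows a.1 a.2)
    (mkseq (fun i => N.setbit N0 (N.of_nat i)) n) arcs.

(** The test of a leaf is that the tails followed by the heads form a single
    chain, which implies that all pairs of arcs cross. *)
Fixpoint refutes rows t : bool :=
  match t with
  | Twist s =>
      [&& size s == k, all (mem arcs) s
        & sorted (fun u v => (u != v) && known rows u v) (unzip1 s ++ unzip2 s)]
  | Compare u v t1 t2 =>
      [&& u < n, v < n, u != v, refutes (learn rows u v) t1 & refutes (learn rows v u) t2]
  end.

Section Soundness.
Variable lt : rel (list_dag arcs_incr).
Hypothesis lt_topo : topological_ordering lt.

Definition sound rows := forall u v : 'I_n, known rows u v -> u = v \/ lt u v.

Lemma known_learn rows (u v x y : nat) : known (learn rows u v) x y ->
  known rows x y \/ known rows x u /\ known rows v y.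
Proof.
rewrite /known /learn; have [x_lt|x_ge] := ltnP x (size rows).
  rewrite (nth_map N0) //; case: ifP => xu; last by left.
  by rewrite N.lor_spec => /orP[xy|vy]; [left|right].
by rewrite nth_default ?size_map.
Qed.

Lemma sound_learn rows (u v : 'I_n) : sound rows -> lt u v -> sound (learn rows u v).
Proof.
have [_ lt_trans _ _] := lt_topo.
move=> rows_ok lt_uv x y /known_learn[/rows_ok //|[/rows_ok xu /rows_ok vy]].
right; case: xu vy => [->|lt_xu] [<-|lt_vy] //.
- exact: lt_trans lt_uv lt_vy.
- exact: lt_trans lt_xu lt_uv.
- exact: lt_trans lt_xu (lt_trans _ _ _ lt_uv lt_vy).
Qed.

Lemma sound_initial : sound initial_rows.
Proof.
have [_ _ _ arc_lt] := lt_topo; rewrite /initial_rows.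
set diag := mkseq _ _; have : sound diag.
  move=> u v; rewrite /known nth_mkseq // N.setbit_eqb N.bits_0 orbF.
  by move=> /N.eqb_spec/Nnat.Nat2N.inj uv; left; exact: val_inj.
have [es <-] := ends_surjective arcs_incr (fun a (arcs_a : a \in arcs) => arcs_a).
elim: es diag => //= e es IHs rows rows_ok.
by apply: IHs; apply: sound_learn => //; apply: arc_lt; exact: (valP e).
Qed.

(** Every ordering follows a branch of the tree, along which [sound] is
    preserved, down to a leaf that names one of its twists. *)
Lemma refutes_twist rows t : sound rows -> refutes rows t ->
  exists2 s : seq (edge (list_dag arcs_incr)), size s = k & pairwise (twist_succ lt) s.
Proof.
have [_ lt_trans lt_total _] := lt_topo.
elim: t rows => [s|u v t1 IH1 t2 IH2] rows rows_ok /=.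
  move=> /and3P[/eqP <- /allP/(ends_surjective arcs_incr)[es <-]].
  rewrite size_map /unzip1 /unzip2 -!map_comp.
  have -> : map (fst \o @ends _ _ arcs_incr) es ++ map (snd \o @ends _ _ arcs_incr) es =
      [seq val u | u : 'I_n <- map (@edge_tail _) es ++ map (@edge_head _) es].
    by rewrite map_cat -!map_comp.
  rewrite sorted_map => sorted_es; exists es => //.
  have : sorted lt ([seq edge_tail e | e <- es] ++ [seq edge_head e | e <- es]).
    apply: sub_sorted sorted_es => u v /= /andP[neq_uv /rows_ok[uv|//]].
    by rewrite uv eqxx in neq_uv.
  rewrite sorted_pairwise // pairwise_cat !pairwise_map => /and3P[th tt hh].
  have {tt hh} : pairwise [rel e f | relpre (@edge_tail _) lt e f && relpre (@edge_head _) lt e f] es.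
    by rewrite pairwise_relI tt hh.
  apply: sub_in_pairwise (allss es) => e f /= es_e es_f /andP[te_f he_f].
  by rewrite /twist_succ te_f he_f (allrelP th) // map_f.
move=> /and5P[u_lt v_lt neq_uv r1 r2].
have /orP[lt_uv|lt_vu] := lt_total (Ordinal u_lt) (Ordinal v_lt) neq_uv.
  by apply: IH1 r1; exact: (sound_learn rows_ok lt_uv).
by apply: IH2 r2; exact: (sound_learn rows_ok lt_vu).
Qed.

End Soundness.

Lemma refutes_twist_number t : refutes initial_rows t ->
  k <= twist_number (list_dag arcs_incr).
Proof.
move=> tP; apply: twist_number_geq => lt lt_topo.
exact: (refutes_twist lt_topo (sound_initial lt_topo) tP).
Qed.

End CaseTree.

(** * The graph *)

Definition graph_arcs : seq (nat * nat) := [::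
  (0, 1); (0, 3); (0, 4); (0, 5); (0, 8); (1, 2); (1, 4); (1, 7); (1, 12);
  (1, 16); (2, 9); (2, 12); (2, 16); (3, 8); (3, 29); (4, 5); (4, 6); (4, 7);
  (4, 19); (5, 6); (5, 8); (5, 10); (5, 20); (6, 19); (6, 20); (7, 16);
  (7, 19); (8, 10); (8, 23); (8, 24); (8, 27); (8, 29); (9, 11); (9, 12);
  (9, 14); (9, 16); (9, 18); (10, 20); (11, 13); (11, 16); (11, 18);
  (12, 14); (12, 18); (12, 30); (13, 15); (13, 16); (13, 17); (13, 25);
  (14, 18); (15, 18); (15, 25); (16, 17); (16, 19); (16, 22); (16, 28);
  (17, 25); (17, 28); (18, 25); (18, 30); (19, 20); (19, 21); (19, 23);
  (19, 27); (19, 29); (20, 23); (21, 22); (21, 29); (22, 28); (23, 24);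
  (24, 27); (25, 26); (25, 30); (26, 28); (27, 29); (28, 29); (28, 30);
  (29, 30)].

Definition abscissae : seq Z := [::
  37; 27; 25; 39; 25; 29; 24; 20; 32; 8; 28; 7; 0; 7; 1; 4; 8; 6; 1; 12; 12;
  8; 7; 10; 10; 3; 3; 6; 4; 4; 2]%coqZ.

Lemma graph_arcs_incr : all (fun a => a.1 < a.2 < 31) graph_arcs.
Proof. by []. Qed.

Lemma graph_drawing : integer_drawing 31 graph_arcs abscissae.
Proof. by vm_compute. Qed.

(** Most inner nodes have a leaf as first branch: the first outcome of
    the comparison would complete that twist, so the second one is a consequence
    of the comparisons made above it. *)
Definition twist_cases : case_tree :=
  Compare 21 8 (Twist [:: (0, 8); (5, 10); (6, 20); (19, 27); (21, 29)]) (
  Compare 16 12 (Twist [:: (1, 16); (2, 12); (9, 14); (11, 18); (13, 25)]) (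
  Compare 17 5 (Twist [:: (0, 5); (4, 6); (7, 19); (16, 22); (17, 28)]) (
  Compare 25 6 (Twist [:: (4, 6); (7, 19); (16, 22); (17, 28); (25, 30)]) (
  Compare 8 12 (Twist [:: (1, 16); (4, 19); (5, 20); (8, 29); (12, 30)]) (
  Compare 8 16 (
    Compare 5 12 (Twist [:: (0, 8); (1, 16); (4, 19); (5, 20); (12, 30)]) (
    Compare 18 8 (Twist [:: (0, 8); (1, 16); (13, 17); (15, 25); (18, 30)]) (
    Compare 18 16 (Twist [:: (1, 16); (4, 19); (5, 20); (8, 29); (18, 30)]) (
    Compare 5 7 (Twist [:: (0, 5); (1, 7); (2, 16); (9, 18); (12, 30)]) (
    Compare 12 4 (Twist [:: (0, 4); (1, 7); (2, 16); (9, 18); (12, 30)]) (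
    Compare 16 6 (Twist [:: (1, 16); (4, 6); (7, 19); (5, 20); (8, 29)]) (
    Compare 7 9 (Twist [:: (0, 5); (4, 6); (7, 16); (9, 18); (12, 30)]) (
    Compare 18 19 (Twist [:: (1, 16); (9, 18); (7, 19); (5, 20); (8, 23)]) (
    Compare 3 9 (
      Compare 9 4 (Twist [:: (0, 5); (3, 8); (9, 16); (4, 19); (12, 18)]) (
      Twist [:: (0, 8); (1, 16); (4, 19); (9, 18); (12, 30)])) (
    Compare 12 3 (Twist [:: (0, 8); (1, 16); (4, 19); (12, 18); (3, 29)]) (
    Twist [:: (0, 8); (1, 16); (9, 18); (3, 29); (12, 30)]))))))))))) (
  Compare 16 18 (
    Compare 12 4 (Twist [:: (0, 4); (1, 7); (2, 16); (9, 18); (12, 30)]) (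
    Compare 18 5 (Twist [:: (0, 5); (4, 6); (7, 19); (16, 28); (18, 30)]) (
    Compare 13 4 (Twist [:: (0, 4); (1, 7); (2, 16); (9, 18); (13, 25)]) (
    Compare 8 18 (
      Compare 19 8 (Twist [:: (0, 8); (9, 18); (13, 25); (16, 28); (19, 29)]) (
      Compare 28 20 (Twist [:: (5, 20); (8, 24); (19, 27); (21, 29); (28, 30)]) (
      Compare 19 18 (
        Compare 4 11 (Twist [:: (0, 8); (4, 19); (11, 18); (13, 25); (16, 28)]) (
        Compare 12 13 (Twist [:: (4, 19); (12, 18); (13, 25); (16, 28); (8, 29)]) (
        Compare 14 16 (Twist [:: (1, 12); (9, 14); (11, 16); (4, 19); (13, 25)]) (
        Twist [:: (1, 12); (2, 16); (9, 14); (11, 18); (13, 25)])))) (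
      Compare 5 16 (Twist [:: (4, 19); (5, 20); (16, 28); (8, 29); (18, 30)]) (
      Compare 19 25 (Twist [:: (4, 19); (13, 25); (16, 28); (8, 29); (18, 30)]) (
      Twist [:: (13, 25); (16, 19); (5, 20); (8, 29); (18, 30)])))))) (
    Compare 19 18 (Twist [:: (0, 8); (5, 10); (6, 20); (19, 29); (18, 30)]) (
    Compare 25 19 (
      Compare 8 19 (
        Compare 28 20 (Twist [:: (5, 20); (8, 24); (19, 27); (21, 29); (28, 30)]) (
        Compare 25 8 (Twist [:: (0, 8); (4, 19); (16, 22); (17, 28); (25, 30)]) (
        Compare 5 16 (Twist [:: (4, 19); (5, 20); (16, 28); (8, 29); (25, 30)]) (
        Twist [:: (0, 8); (13, 25); (16, 19); (5, 20); (18, 30)])))) (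
      Compare 5 16 (Twist [:: (4, 19); (5, 8); (16, 22); (17, 28); (25, 30)]) (
      Compare 28 20 (Twist [:: (5, 20); (19, 23); (8, 27); (21, 29); (28, 30)]) (
      Compare 17 6 (Twist [:: (4, 6); (13, 25); (16, 19); (5, 20); (17, 28)]) (
      Twist [:: (13, 25); (16, 19); (5, 10); (6, 20); (17, 28)]))))) (
    Compare 8 19 (Twist [:: (0, 8); (4, 19); (13, 25); (16, 28); (18, 30)]) (
    Compare 25 8 (Twist [:: (0, 8); (5, 10); (6, 20); (19, 29); (25, 30)]) (
    Compare 28 20 (Twist [:: (5, 20); (19, 23); (8, 27); (21, 29); (28, 30)]) (
    Compare 25 10 (Twist [:: (5, 10); (6, 20); (19, 27); (8, 29); (25, 30)]) (
    Compare 6 16 (Twist [:: (0, 8); (5, 10); (6, 20); (16, 28); (19, 29)]) (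
    Compare 5 13 (Twist [:: (0, 8); (5, 10); (13, 25); (16, 28); (19, 29)]) (
    Compare 5 12 (Twist [:: (0, 5); (1, 12); (2, 16); (9, 18); (13, 25)]) (
    Compare 5 7 (Twist [:: (0, 5); (1, 7); (2, 16); (9, 18); (13, 25)]) (
    Compare 16 5 (
      Compare 7 13 (Twist [:: (0, 5); (4, 6); (7, 19); (13, 25); (16, 28)]) (
      Compare 7 12 (Twist [:: (1, 7); (2, 12); (9, 16); (11, 18); (13, 25)]) (
      Compare 9 4 (Twist [:: (1, 7); (2, 16); (9, 18); (4, 19); (12, 30)]) (
      Compare 6 18 (Twist [:: (0, 5); (4, 6); (9, 18); (13, 25); (16, 28)]) (
      Compare 17 18 (Twist [:: (4, 6); (7, 19); (16, 22); (17, 28); (18, 30)]) (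
      Compare 17 19 (Twist [:: (0, 5); (9, 18); (13, 17); (7, 19); (16, 28)]) (
      Compare 15 16 (Twist [:: (0, 5); (9, 18); (13, 17); (15, 25); (16, 28)]) (
      Twist [:: (4, 6); (7, 19); (16, 17); (15, 25); (18, 30)])))))))) (
    Compare 4 9 (
      Compare 7 13 (Twist [:: (0, 5); (1, 16); (4, 6); (7, 19); (13, 25)]) (
      Twist [:: (1, 7); (4, 5); (9, 16); (11, 18); (13, 25)])) (
    Twist [:: (0, 5); (1, 16); (9, 18); (4, 19); (12, 30)]))))))))))))))))) (
  Compare 18 7 (Twist [:: (1, 7); (2, 16); (13, 17); (15, 25); (18, 30)]) (
  Compare 13 4 (Twist [:: (0, 4); (1, 7); (9, 18); (11, 16); (13, 25)]) (
  Compare 16 5 (Twist [:: (1, 16); (4, 5); (13, 17); (15, 25); (18, 30)]) (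
  Compare 19 17 (Twist [:: (1, 16); (4, 19); (13, 17); (15, 25); (18, 30)]) (
  Compare 19 8 (
    Compare 10 22 (Twist [:: (0, 8); (5, 10); (16, 22); (17, 28); (19, 29)]) (
    Twist [:: (5, 10); (6, 20); (19, 23); (8, 27); (21, 29)])) (
  Compare 25 8 (Twist [:: (0, 8); (4, 19); (16, 22); (17, 28); (25, 30)]) (
  Compare 28 20 (Twist [:: (5, 20); (8, 24); (19, 27); (21, 29); (28, 30)]) (
  Compare 25 19 (Twist [:: (4, 19); (5, 20); (16, 28); (8, 29); (25, 30)]) (
  Compare 18 5 (Twist [:: (0, 5); (1, 16); (4, 19); (13, 25); (18, 30)]) (
  Compare 20 25 (Twist [:: (4, 19); (5, 20); (18, 25); (16, 28); (8, 29)]) (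
  Compare 21 25 (Twist [:: (5, 20); (8, 24); (19, 27); (21, 29); (25, 30)]) (
  Compare 28 27 (Twist [:: (5, 20); (16, 28); (8, 27); (19, 29); (25, 30)]) (
  Compare 8 17 (Twist [:: (5, 20); (8, 27); (17, 28); (19, 29); (25, 30)]) (
  Twist [:: (4, 19); (13, 25); (16, 22); (17, 28); (8, 29)])))))))))))))))))))).

Lemma twist_cases_refute :
  refutes 31 5 graph_arcs (initial_rows 31 graph_arcs) twist_cases.
Proof. by vm_compute. Qed.

Theorem theorem5 (R : realType) :
  exists G : dag,
    upward_planar R G /\
    (twist_number G <= page_number G)%N /\
    (5 <= twist_number G)%N.
Proof.
exists (list_dag graph_arcs_incr); split; first exact: integer_upward_planar graph_drawing.
split; first exact: twist_number_leq_page_number.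
exact: (@refutes_twist_number _ _ _ graph_arcs_incr _ twist_cases_refute).
Qed.
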